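(* Let $\{x^k\}$ be generated by the algorithm ADOM+ (with the parameters given in the context). To reach precision $\|x^k-x^*\|^2\le\epsilon$, ADOM+ requires $$\mathcal O\left(\chi\sqrt{L/\mu}\,\log\frac1\epsilon\right)$$ iterations.
   Context: **Problem.** $\mathcal V=\{1,\dots,n\}$; $f_i:\mathbb R^d\to\mathbb R$, $i\in\mathcal V$, are $L$-smooth and $\mu$-strongly convex, $0<\mu\le L$, i.e. $f_i(y)+\langle\nabla f_i(y),x-y\rangle+\frac\mu2\|x-y\|^2\le f_i(x)\le f_i(y)+\langle\nabla f_i(y),x-y\rangle+\frac L2\|x-y\|^2$ for all $x,y\in\mathbb R^d$. $F:(\mathbb R^d)^{\mathcal V}\to\mathbb R$, $F(x)=\sum_{i}f_i(x_i)$; $\mathcal L=\{x\in(\mathbb R^d)^{\mathcal V}:x_1=\dots=x_n\}$; $\mathcal L^\perp=\{z\in(\mathbb R^d)^{\mathcal V}:\sum_iz_i=0\}$. $x^*\in\mathcal L$ is the unique solution of $\min_{x\in\mathcal L}F(x)$, equivalently all its components equal the minimizer of $\sum_if_i$ over $\mathbb R^d$. **Gossip matrices.** For rounds $q=0,1,2,\dots$ there are graphs $\mathcal G^q=(\mathcal V,\mathcal E^q)$, $\mathcal E^q\subset\{(i,j):i\neq j\}$, and matrices $\mathbf W(q)\in\mathbb R^{n\times n}$ with: $\mathbf W(q)_{i,j}\ne0$ iff $(i,j)\in\mathcal E^q$ or $i=j$; $\ker\mathbf W(q)\supset\{x\in\mathbb R^n:x_1=\dots=x_n\}$; $\mathrm{range}\,\mathbf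 W(q)\subset\{x\in\mathbb R^n:\sum_ix_i=0\}$; and there is $\chi\ge1$, common to all $q$, with $\|\mathbf W(q)x-x\|^2\le(1-\chi^{-1})\|x\|^2$ whenever $\sum_ix_i=0$. **ADOM+.** Input $x^0,y^0,m^0\in(\mathbb R^d)^{\mathcal V}$, $z^0\in\mathcal L^\perp$; set $x_f^0=x^0$, $y_f^0=y^0$, $z_f^0=z^0$. For $k=0,1,2,\dots$ (the equations for $x^{k+1},y^{k+1}$ are solved jointly): - $x_g^k=\tau_1x^k+(1-\tau_1)x_f^k$ - $x^{k+1}=x^k+\eta\alpha(x_g^k-x^{k+1})-\eta[\nabla F(x_g^k)-\nu x_g^k-y^{k+1}]$ - $x_f^{k+1}=x_g^k+\tau_2(x^{k+1}-x^k)$ - $y_g^k=\sigma_1y^k+(1-\sigma_1)y_f^k$ - $y^{k+1}=y^k+\theta\beta(\nabla F(x_g^k)-\nu x_g^k-y^{k+1})-\theta[\nu^{-1}(y_g^k+z_g^k)+x^{k+1}]$ - $y_f^{k+1}=y_g^k+\sigma_2(y^{k+1}-y^k)$ - $z_g^k=\sigma_1z^k+(1-\sigma_1)z_f^k$ - $z^{k+1}=z^k+\gamma\delta(z_g^k-z^k)-(\mathbf W(k)\otimes\mathbf I_d)[\gamma\nu^{-1}(y_g^k+z_g^k)+m^k]$ - $m^{k+1}=\gamma\nu^{-1}(y_g^k+z_g^k)+m^k-(\mathbf W(k)\otimes\mathbf I_d)[\gamma\nu^{-1}(y_g^k+z_g^k)+m^k]$ - $z_f^{k+1}=z_g^k-\zeta(\mathbf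 W(k)\otimes\mathbf I_d)(y_g^k+z_g^k)$ **Parameters.** $\tau_2=\sqrt{\mu/L}$, $\tau_1=(1/\tau_2+1/2)^{-1}$, $\eta=(L\tau_2)^{-1}$, $\alpha=\mu/2$, $\nu=\mu/2$, $\beta=1/(2L)$, $\sigma_2=\frac{\sqrt\mu}{16\chi\sqrt L}$, $\sigma_1=(1/\sigma_2+1/2)^{-1}$, $\theta=\frac{\nu}{4\sigma_2}$, $\gamma=\frac{\nu}{14\sigma_2\chi^2}$, $\delta=\frac1{17L}$, $\zeta=\frac12$. **Asymptotic notation.** $\mathcal O(\cdot)$ hides a universal constant, for $\epsilon>0$ below a threshold that may depend on the problem and the initial point (i.e. the additive dependence of the logarithm on the initialization is suppressed). *)

(* Defs.v *)
From mathcomp Require Export all_boot all_order all_algebra.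
From mathcomp Require Export all_classical all_reals all_analysis.
Export Order.TTheory GRing.Theory Num.Theory.
Export numFieldNormedType.Exports.

Set Implicit Arguments.
Unset Strict Implicit.
Unset Printing Implicit Defensive.

Local Open Scope classical_set_scope.
Local Open Scope ring_scope.

(* A vector of R^d is a row 'rV[R]_d.  An element x of (R^d)^V, V = 'I_n, is a
   matrix 'M[R]_(n, d) whose i-th row is x_i; with this encoding
   (W (x) I_d) x is the matrix product W *m x, for W : 'M[R]_n. *)

(* Euclidean structure; the library norm `|_| on matrices is the sup norm. *)
Definition inner (R : realType) (m n : nat) (u v : 'M[R]_(m, n)) : R :=
  \sum_i \sum_j u i j * v i j.

Definition sqnorm (R : realType) (m n : nat) (u : 'M[R]_(m, n)) : R :=
  inner u u.

Definition grad (R : realType) (m n : nat) (f : 'M[R]_(m, n) -> R)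
    (x : 'M[R]_(m, n)) : 'M[R]_(m, n) :=
  \matrix_(i, j) 'D_(delta_mx i j) f x.

Definition strongly_convex (R : realType) (d : nat) (mu : R)
    (f : 'rV[R]_d -> R) : Prop :=
  forall x y, f y + inner (grad f y) (x - y) + mu / 2 * sqnorm (x - y) <= f x.

Definition smooth (R : realType) (d : nat) (L : R) (f : 'rV[R]_d -> R) : Prop :=
  (forall y, differentiable f y) /\
  forall x y, f x <= f y + inner (grad f y) (x - y) + L / 2 * sqnorm (x - y).

Definition sum_objective (R : realType) (n d : nat)
    (f : 'I_n -> 'rV[R]_d -> R) (x : 'M[R]_(n, d)) : R :=
  \sum_i f i (row i x).

(* These are used both on (R^d)^V and, with d = 1, on R^n. *)
Definition consensus (R : realType) (n d : nat) : set 'M[R]_(n, d) :=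
  [set x | forall i j, row i x = row j x].
Arguments consensus : clear implicits.

Definition zero_sum (R : realType) (n d : nat) : set 'M[R]_(n, d) :=
  [set z | \sum_i row i z = 0].
Arguments zero_sum : clear implicits.

Definition is_minimizer (R : realType) (T : Type) (F : T -> R) (A : set T)
    (x : T) : Prop :=
  A x /\ forall y, A y -> F x <= F y.

Definition gossip_matrix (R : realType) (n : nat) (chi : R) (E : rel 'I_n)
    (W : 'M[R]_n) : Prop :=
  [/\ forall i j, W i j != 0 <-> E i j \/ i = j,
      consensus R n 1 `<=` [set x | W *m x = 0],
      range (fun x : 'cV[R]_n => W *m x) `<=` zero_sum R n 1 &
      forall x : 'cV[R]_n, zero_sum R n 1 x ->
        sqnorm (W *m x - x) <= (1 - chi^-1) * sqnorm x].

Record adom_params (R : realType) := AdomParams {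
  tau1 : R; tau2 : R; eta : R; alpha : R; nu : R; beta : R;
  sigma1 : R; sigma2 : R; theta : R; gamma : R; delta : R; zeta : R }.

Definition adom_default (R : realType) (L mu chi : R) : adom_params R :=
  let tau2 := Num.sqrt (mu / L) in
  let nu := mu / 2 in
  let sigma2 := Num.sqrt mu / (16 * chi * Num.sqrt L) in
  {| tau1 := (tau2^-1 + 2^-1)^-1;
     tau2 := tau2;
     eta := (L * tau2)^-1;
     alpha := mu / 2;
     nu := nu;
     beta := (2 * L)^-1;
     sigma1 := (sigma2^-1 + 2^-1)^-1;
     sigma2 := sigma2;
     theta := nu / (4 * sigma2);
     gamma := nu / (14 * sigma2 * chi ^+ 2);
     delta := (17 * L)^-1;
     zeta := 2^-1 |}.

Record adom_state (R : realType) (n d : nat) := AdomState {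
  st_x : 'M[R]_(n, d); st_xf : 'M[R]_(n, d);
  st_y : 'M[R]_(n, d); st_yf : 'M[R]_(n, d);
  st_z : 'M[R]_(n, d); st_zf : 'M[R]_(n, d);
  st_m : 'M[R]_(n, d) }.

Definition adom_init (R : realType) (n d : nat) (x0 y0 z0 m0 : 'M[R]_(n, d)) :
    adom_state R n d :=
  {| st_x := x0; st_xf := x0; st_y := y0; st_yf := y0;
     st_z := z0; st_zf := z0; st_m := m0 |}.

(* One iteration, as a relation between consecutive states: the equations for
   st_x s' and st_y s' are implicit and coupled. *)
Definition adom_step (R : realType) (n d : nat) (p : adom_params R)
    (F : 'M[R]_(n, d) -> R) (W : 'M[R]_n) (s s' : adom_state R n d) : Prop :=
  let xg := tau1 p *: st_x s + (1 - tau1 p) *: st_xf s in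
  let yg := sigma1 p *: st_y s + (1 - sigma1 p) *: st_yf s in
  let zg := sigma1 p *: st_z s + (1 - sigma1 p) *: st_zf s in
  let g := grad F xg - nu p *: xg in
  let u := (gamma p / nu p) *: (yg + zg) + st_m s in
  [/\ st_x s' = st_x s + (eta p * alpha p) *: (xg - st_x s')
                - eta p *: (g - st_y s'),
      st_xf s' = xg + tau2 p *: (st_x s' - st_x s),
      st_y s' = st_y s + (theta p * beta p) *: (g - st_y s')
                - theta p *: ((nu p)^-1 *: (yg + zg) + st_x s') &
      st_yf s' = yg + sigma2 p *: (st_y s' - st_y s)] /\
  [/\ st_z s' = st_z s + (gamma p * delta p) *: (zg - st_z s) - W *m u,
      st_m s' = u - W *m u &
      st_zf s' = zg - zeta p *: (W *m (yg + zg))].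

Definition adom_run (R : realType) (n d : nat) (p : adom_params R)
    (F : 'M[R]_(n, d) -> R) (W : nat -> 'M[R]_n)
    (s0 : adom_state R n d) (s : nat -> adom_state R n d) : Prop :=
  s 0%N = s0 /\ forall k, adom_step p F (W k) (s k) (s k.+1).

(* Main.v *)
Require Import Defs.
From mathcomp Require Import all_boot all_order all_algebra.
From mathcomp Require Import all_classical all_reals all_analysis.
From mathcomp Require Import ring lra.

(* The iteration has the fixed point x = x*, y = grad F(x* ) - nu x*,
   z = - grad F(x* ); the latter lies in the zero-sum space by optimality of x*.
   Let X, Y, Z be the errors, P the projection onto the zero-sum space, and D the
   Bregman divergence of F - (nu/2)|.|^2 to x*.  The vector z - P m obeys a
   recursion in which the gossip matrix no longer appears, so m acts as an error
   feedback: P m itself contracts by the factor 1 - 1/chi at each round, up to the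
   injected term (gamma/nu) P(y_g + z_g).  The energy
     (1/eta + alpha)|X|^2 + (2/tau2) D(x_f) + (1/theta + beta/2)|Y|^2
     + (beta/(2 sigma2))|Y_f|^2 + (1/gamma)|Z - P m|^2 + (1/gamma)|P m|^2
     + (1/(nu sigma2))|Y_f + Z_f|^2
   then decreases by the factor 1 - sigma2/8: the inner products coupling the
   blocks x, y and z telescope, and the injected term is absorbed by the decrease
   of |Y_f + Z_f|^2 obtained from the gossip step with zeta = 1/2.  With
   sigma2 = sqrt(mu/L)/(16 chi), k >= 256 chi sqrt(L/mu) log(1/eps) iterations
   shrink the energy by eps^2, and one factor eps absorbs the initial energy. *)

Local Open Scope classical_set_scope.
Local Open Scope ring_scope.

(** * Euclidean inner product on (R^d)^V *)

Section Inner.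
Context {R : realType} {n d : nat}.
Implicit Types (u v w : 'M[R]_(n, d)) (a : R).

Lemma inner_tr u v : inner u v = \tr (u^T *m v).
Proof.
rewrite /inner /mxtrace exchange_big; apply: eq_bigr => j _.
by rewrite mxE; apply: eq_bigr => i _; rewrite mxE.
Qed.

Lemma innerC u v : inner u v = inner v u.
Proof. by do 2!apply: eq_bigr => ? _; rewrite mulrC. Qed.

Lemma innerDl u v w : inner (u + v) w = inner u w + inner v w.
Proof. by rewrite !inner_tr linearD mulmxDl linearD. Qed.

Lemma innerNl u v : inner (- u) v = - inner u v.
Proof. by rewrite !inner_tr linearN mulNmx linearN. Qed.

Lemma innerZl a u v : inner (a *: u) v = a * inner u v.
Proof. by rewrite !inner_tr linearZ -scalemxAl linearZ. Qed.

Lemma innerDr u v w : inner u (v + w) = inner u v + inner u w.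
Proof. by rewrite !(innerC u) innerDl. Qed.

Lemma innerNr u v : inner u (- v) = - inner u v.
Proof. by rewrite !(innerC u) innerNl. Qed.

Lemma innerZr a u v : inner u (a *: v) = a * inner u v.
Proof. by rewrite !(innerC u) innerZl. Qed.

Lemma inner0l u : inner 0 u = 0.
Proof. by rewrite -(scale0r u) innerZl mul0r. Qed.

Lemma inner0r u : inner u 0 = 0.
Proof. by rewrite innerC inner0l. Qed.

Definition innerE := (innerDl, innerDr, innerNl, innerNr, innerZl, innerZr).

Lemma inner_mulmxl (A : 'M[R]_n) u v : inner (A *m u) v = inner u (A^T *m v).
Proof. by rewrite !inner_tr trmx_mul mulmxA. Qed.

Lemma inner_row u v : inner u v = \sum_i inner (row i u) (row i v).
Proof.
apply: eq_bigr => i _; rewrite /inner big_ord1.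
by apply: eq_bigr => j _; rewrite !mxE.
Qed.

Lemma inner_col u v : inner u v = \sum_j inner (col j u) (col j v).
Proof.
rewrite /inner exchange_big; apply: eq_bigr => j _.
by apply: eq_bigr => i _; rewrite big_ord1 !mxE.
Qed.

Lemma sqnorm_ge0 u : 0 <= inner u u.
Proof. by do 2!apply: sumr_ge0 => ? _; rewrite -expr2 sqr_ge0. Qed.

Lemma sqnorm_le0 u : inner u u <= 0 -> u = 0.
Proof.
move=> u0; have {}u0 : inner u u == 0 by rewrite eq_le u0 sqnorm_ge0.
apply/matrixP => i j; rewrite mxE; apply/eqP; rewrite -sqrf_eq0 expr2.
move: u0; rewrite psumr_eq0 => [/allP/(_ i)|k _]; last first.
  by apply: sumr_ge0 => ? _; rewrite -expr2 sqr_ge0.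
rewrite mem_index_enum psumr_eq0 => [/(_ isT)/allP/(_ j)|k _]; last first.
  by rewrite -expr2 sqr_ge0.
by rewrite mem_index_enum; apply.
Qed.

Lemma young_inner a u v : 0 < a ->
  2 * inner u v <= a * inner u u + a^-1 * inner v v.
Proof.
move=> a0; have := sqnorm_ge0 (a *: u - v).
rewrite !innerE (innerC v) => H.
rewrite -(ler_pM2l a0) mulrDr mulrA mulrA mulrA divff ?gt_eqF //; lra.
Qed.

End Inner.


Lemma col_mulmx {R : realType} {m n d : nat} (A : 'M[R]_(m, n)) (u : 'M[R]_(n, d)) j :
  col j (A *m u) = A *m col j u.
Proof. by rewrite !colE mulmxA. Qed.

(** * Orthogonal projection onto the zero-sum space *)

Section Centering.
Context {R : realType} {n : nat}.

Definition mean_mx : 'M[R]_n := n%:R^-1 *: const_mx 1.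
Definition centering_mx : 'M[R]_n := 1%:M - mean_mx.

Lemma zero_sumP {d} (u : 'M[R]_(n, d)) :
  zero_sum R n d u <-> forall j, \sum_k u k j = 0.
Proof.
split=> [u0 j|u0].
  have := congr1 (fun w : 'rV_d => w 0 j) u0; rewrite summxE mxE.
  by under eq_bigr do rewrite mxE.
by apply/rowP => j; rewrite summxE mxE; under eq_bigr do rewrite mxE.
Qed.

Lemma mean_mxE {d} (u : 'M[R]_(n, d)) i j :
  (mean_mx *m u) i j = n%:R^-1 * \sum_k u k j.
Proof.
by rewrite -scalemxAl !mxE; congr (_ * _); apply: eq_bigr => k _; rewrite !mxE mul1r.
Qed.

Lemma centering_mxE {d} (u : 'M[R]_(n, d)) : centering_mx *m u = u - mean_mx *m u.
Proof. by rewrite mulmxBl mul1mx. Qed.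

Lemma zero_sum_center {d} (u : 'M[R]_(n, d)) :
  zero_sum R n d u -> centering_mx *m u = u.
Proof.
move=> /zero_sumP u0; rewrite centering_mxE; apply/matrixP => i j.
by rewrite mxE [X in _ + X]mxE mean_mxE u0 mulr0 subr0.
Qed.

Lemma consensus_mean {d} (u : 'M[R]_(n, d)) : consensus R n d (mean_mx *m u).
Proof. by move=> i j; apply/rowP => k; rewrite [LHS]mxE [RHS]mxE !mean_mxE. Qed.

Lemma center_zero_sum {d} (u : 'M[R]_(n, d)) : zero_sum R n d (centering_mx *m u).
Proof.
apply/zero_sumP => j; rewrite centering_mxE.
under eq_bigr do rewrite mxE [X in _ + X]mxE mean_mxE.
rewrite sumrB sumr_const card_ord -mulrnAl -mulr_natr.
(* For n = 0 the factor [n%:R^-1] is 0 and cannot cancel n, but then the column sums are empty. *)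
have [n0|n_gt0] := posnP n; last by rewrite mulVf ?mul1r ?subrr // pnatr_eq0 -lt0n.
rewrite big1 => [|i _]; first by rewrite mulr0 subr0.
by exfalso; move: (ltn_ord i); rewrite [X in (_ < X)%N]n0.
Qed.

Lemma consensus_center {d} (u : 'M[R]_(n, d)) :
  consensus R n d u -> centering_mx *m u = 0.
Proof.
move=> u_cst; rewrite centering_mxE; apply/matrixP => i j.
rewrite mxE [X in _ + X]mxE mean_mxE mxE.
have eq_u k : u k j = u i j.
  by have := congr1 (fun w : 'rV_d => w 0 j) (u_cst k i); rewrite !mxE.
under eq_bigr do rewrite eq_u.
rewrite sumr_const card_ord -[u i j *+ n]mulr_natl mulrA mulVf ?mul1r ?subrr //.
by rewrite pnatr_eq0 -lt0n (leq_ltn_trans _ (ltn_ord i)).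
Qed.

Lemma trmx_center : centering_mx^T = centering_mx.
Proof. by rewrite linearB /= trmx1 linearZ /= trmx_const. Qed.

Lemma center_idem {d} (u : 'M[R]_(n, d)) :
  centering_mx *m (centering_mx *m u) = centering_mx *m u.
Proof. by rewrite (zero_sum_center _ (center_zero_sum u)). Qed.

Lemma inner_centerl {d} (u v : 'M[R]_(n, d)) :
  inner (centering_mx *m u) v = inner (centering_mx *m u) (centering_mx *m v).
Proof. by rewrite -[in LHS]center_idem inner_mulmxl trmx_center. Qed.

End Centering.
Arguments mean_mx : clear implicits.
Arguments centering_mx : clear implicits.

Lemma zero_sum_lin {R : realType} {n d : nat} (a b : R) (u v : 'M[R]_(n, d)) :
  zero_sum R n d u -> zero_sum R n d v -> zero_sum R n d (a *: u + b *: v).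
Proof.
move=> /zero_sumP u0 /zero_sumP v0; apply/zero_sumP => j.
under eq_bigr do rewrite !mxE.
by rewrite big_split /= -!mulr_sumr u0 v0 !mulr0 addr0.
Qed.

Lemma inner_center_zero_sum {R : realType} {n d : nat} (u v : 'M[R]_(n, d)) :
  zero_sum R n d v -> inner (centering_mx R n *m u) v = inner u v.
Proof. by move=> /zero_sum_center v0; rewrite inner_mulmxl trmx_center v0. Qed.

(** * Gossip matrices acting on (R^d)^V *)

Section Gossip.
Context {R : realType} {n : nat} {chi : R} {E : rel 'I_n} {W : 'M[R]_n}.
Hypothesis gW : gossip_matrix chi E W.

Lemma gossip_zero_sum {d} (u : 'M[R]_(n, d)) : zero_sum R n d (W *m u).
Proof.
case: gW => _ _ rW _; apply/zero_sumP => j.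
have /rW/zero_sumP/(_ 0) : range (fun x : 'cV[R]_n => W *m x) (W *m col j u).
  by exists (col j u).
by rewrite -col_mulmx; under eq_bigr do rewrite mxE.
Qed.

Lemma gossip_consensus {d} (u : 'M[R]_(n, d)) : consensus R n d u -> W *m u = 0.
Proof.
case: gW => _ kW _ _ u_cst; apply/matrixP => i j.
have : [set x | W *m x = 0] (col j u).
  apply: kW => k l; apply/rowP => m; rewrite !mxE.
  by have := congr1 (fun w : 'rV_d => w 0 j) (u_cst k l); rewrite !mxE.
rewrite /= -col_mulmx => /(congr1 (fun w : 'cV_n => w i 0)).
by rewrite !mxE.
Qed.

Lemma gossip_center {d} (u : 'M[R]_(n, d)) : W *m (centering_mx R n *m u) = W *m u.
Proof.
by rewrite centering_mxE mulmxBr (gossip_consensus _ (consensus_mean u)) subr0.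
Qed.

(** Both squared norms split over the d columns, and W acts on each column separately, so the
    contraction on R^n applies column by column. *)
Lemma gossip_contract {d} (u : 'M[R]_(n, d)) : zero_sum R n d u ->
  sqnorm (W *m u - u) <= (1 - chi^-1) * sqnorm u.
Proof.
case: gW => _ _ _ cW /zero_sumP u0; rewrite /sqnorm !inner_col mulr_sumr.
apply: ler_sum => j _; rewrite linearB /= col_mulmx; apply: cW.
by apply/zero_sumP => k; under eq_bigr do rewrite mxE.
Qed.

End Gossip.

(** * Gradient, smoothness and convexity of the separable objective *)

Section Objective.
Context {R : realType} {n d : nat} (f : 'I_n -> 'rV[R]_d -> R).

(** A perturbation along [delta_mx i j] changes only the i-th summand, so the two difference
    quotients already coincide as functions of h, before the limit. *)
Lemma row_grad_sum_objective (x : 'M[R]_(n, d)) i :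
  row i (grad (sum_objective f) x) = grad (f i) (row i x).
Proof.
apply/rowP => j; rewrite !mxE /derive.
suff -> : (fun h : R => h^-1 *: ((sum_objective f \o shift x) (h *: delta_mx i j)
      - sum_objective f x)) =
    (fun h : R => h^-1 *: ((f i \o shift (row i x)) (h *: 'e_j) - f i (row i x))).
  by [].
apply/funext => h /=; congr (_ *: _).
rewrite /sum_objective (bigD1 i) //= [in X in _ - X](bigD1 i) //=.
rewrite (eq_bigr (fun k => f k (row k x))) => [|k ki].
  rewrite opprD addrACA subrr addr0; congr (f i _ - _).
  by apply/rowP => l; rewrite !mxE eqxx.
congr (f k _); apply/rowP => l.
by rewrite !mxE (negbTE ki) mulr0 add0r.
Qed.

End Objective.

Section SumObjective.
Context {R : realType} {n d : nat} {f : 'I_n -> 'rV[R]_d -> R} {L mu : R}.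
Hypothesis f_reg : forall i, smooth L (f i) /\ strongly_convex mu (f i).
Local Notation F := (sum_objective f).
Implicit Types u v : 'M[R]_(n, d).

Lemma sum_objective_smooth u v :
  F u <= F v + inner (grad F v) (u - v) + L / 2 * inner (u - v) (u - v).
Proof.
rewrite /sum_objective !inner_row mulr_sumr -!big_split.
apply: ler_sum => i _; rewrite row_grad_sum_objective linearB /=.
by case: (f_reg i) => -[_ fs] _; exact: fs.
Qed.

Lemma sum_objective_strongly_convex u v :
  F v + inner (grad F v) (u - v) + mu / 2 * inner (u - v) (u - v) <= F u.
Proof.
rewrite /sum_objective !inner_row mulr_sumr -!big_split.
apply: ler_sum => i _; rewrite row_grad_sum_objective linearB /=.
by case: (f_reg i) => _ fc; exact: fc.
Qed.

(** With c the mean of the gradient, the step from [xs] to [xs - L^-1 *: c] stays in the consensus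
    space and by smoothness lowers F by at least |c|^2/(2L). Minimality forces c = 0. *)
Lemma grad_minimizer_zero_sum xs : 0 < L ->
  is_minimizer F (consensus R n d) xs -> zero_sum R n d (grad F xs).
Proof.
move=> L0 [xs_cst xs_min].
pose g := grad F xs; pose c := mean_mx R n *m g.
have c_cst : consensus R n d (xs - L^-1 *: c).
  move=> i j; rewrite !(linearB, linearZ) /= (xs_cst i j).
  by rewrite (consensus_mean g i j).
have /le_trans/(_ (sum_objective_smooth _ xs)) := xs_min _ c_cst.
have -> : xs - L^-1 *: c - xs = - L^-1 *: c by rewrite addrAC subrr add0r scaleNr.
have gc : inner g c = inner c c.
  have -> : g = centering_mx R n *m g + c by rewrite centering_mxE subrK.
  rewrite innerDl inner_centerl (consensus_center _ (consensus_mean g)).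
  by rewrite inner0r add0r.
rewrite !innerE -/g gc => H.
have c0 : c = 0.
  apply: sqnorm_le0; rewrite -(ler_pM2l (_ : 0 < (2 * L)^-1)) ?invr_gt0; last lra.
  have -> : (2 * L)^-1 * inner c c =
    L^-1 * inner c c - L / 2 * (L^-1 * (L^-1 * inner c c)) by field; rewrite gt_eqF.
  by rewrite mulr0; lra.
by have := center_zero_sum g; rewrite centering_mxE -/c c0 subr0.
Qed.

End SumObjective.

(** * Bregman divergence to the minimizer *)

Section Bregman.
Context {R : realType} {n d : nat} {F : 'M[R]_(n, d) -> R}.
Context {dF : 'M[R]_(n, d) -> 'M[R]_(n, d)} {L mu : R}.
Hypothesis F_smooth : forall u v : 'M[R]_(n, d),
  F u <= F v + inner (dF v) (u - v) + L / 2 * inner (u - v) (u - v).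
Hypothesis F_convex : forall u v : 'M[R]_(n, d),
  F v + inner (dF v) (u - v) + mu / 2 * inner (u - v) (u - v) <= F u.
Hypotheses (mu_gt0 : 0 < mu) (L_gt0 : 0 < L).
Variable xs : 'M[R]_(n, d).

(* Bregman divergence to [xs] of [F - (nu/2) |.|^2] with [nu = mu/2]; [dbreg u]
   is the difference of the gradients of this function at [u] and [xs]. *)
Definition breg (u : 'M[R]_(n, d)) :=
  F u - F xs - inner (dF xs) (u - xs) - mu / 4 * inner (u - xs) (u - xs).
Definition dbreg (u : 'M[R]_(n, d)) := dF u - dF xs - (mu / 2) *: (u - xs).

Lemma breg_le u v : breg u <=
  breg v + inner (dbreg v) (u - v) + L / 2 * inner (u - v) (u - v).
Proof.
have := F_smooth u v; rewrite /breg /dbreg.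
have -> : u - xs = (u - v) + (v - xs) by rewrite addrA subrK.
move: (u - v) (v - xs) => a b; rewrite !innerE (innerC b a).
have := mulr_ge0 (ltW mu_gt0) (sqnorm_ge0 a); lra.
Qed.

Lemma breg_ge u v :
  breg v + inner (dbreg v) (u - v) + mu / 4 * inner (u - v) (u - v) <= breg u.
Proof.
have := F_convex u v; rewrite /breg /dbreg.
have -> : u - xs = (u - v) + (v - xs) by rewrite addrA subrK.
move: (u - v) (v - xs) => a b; rewrite !innerE (innerC b a); lra.
Qed.

Lemma breg_xs : breg xs = 0.
Proof. by rewrite /breg !subrr !inner0r mulr0 !subr0. Qed.

Lemma breg_ge0 u : 0 <= breg u.
Proof.
have := breg_ge u xs; rewrite breg_xs /dbreg !subrr scaler0 subr0.
rewrite inner0l.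
have := mulr_ge0 (ltW mu_gt0) (sqnorm_ge0 (u - xs)); lra.
Qed.

(** A gradient step of length 1/L from u lowers [breg] by at least the left-hand side, and [breg]
    stays nonnegative. *)
Lemma breg_dual u : (2 * L)^-1 * inner (dbreg u) (dbreg u) <= breg u.
Proof.
have := breg_le (u - L^-1 *: dbreg u) u.
have -> : u - L^-1 *: dbreg u - u = - L^-1 *: dbreg u.
  by rewrite addrAC subrr add0r scaleNr.
have := breg_ge0 (u - L^-1 *: dbreg u).
move: (breg _) (breg u) => b b'; move: (dbreg u) => g b_ge0; rewrite !innerE => le_b.
have -> : (2 * L)^-1 * inner g g =
    L^-1 * inner g g - L / 2 * (L^-1 * (L^-1 * inner g g)).
  by field; rewrite gt_eqF.
lra.
Qed.

Lemma breg_monotone u :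
  breg u + mu / 4 * inner (u - xs) (u - xs) <= inner (dbreg u) (u - xs).
Proof.
have := breg_ge xs u; rewrite breg_xs -(opprB u xs) !innerE; lra.
Qed.

End Bregman.

(** * Separate estimates for the blocks x, y, z, m *)

Section StepEstimates.
Context {R : realType} {n d : nat}.
Implicit Types (X Y Z S G p q w u : 'M[R]_(n, d)).

(** The extrapolation solved for X: with weight a = (1/s + 1/2)^-1 one has 1/a - 1 = 1/s - 1/2. The
    estimates below use this form. *)
Lemma momentumK (s : R) X Xf Xg : 0 < s ->
  Xg = (s^-1 + 2^-1)^-1 *: X + (1 - (s^-1 + 2^-1)^-1) *: Xf ->
  X = Xg + (s^-1 - 2^-1) *: (Xg - Xf).
Proof.
move=> s0 ->; apply/matrixP => i j; rewrite !mxE; field.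
by rewrite !gt_eqF //; lra.
Qed.

(** The implicit update is tested against X'. Smoothness at [Xf'], weighted by 2/t, cancels both <G,
    X'> and the square of X' - X. The remaining <G, X> expands by momentum into differences at Xg
    and Xf, which convexity bounds with weight 2/t - 1. The coupling 2<X', Y'> is left for the y
    block, and -Dg pays for the |G|^2 term there. *)
Lemma x_estimate (L t alpha Df Dg Df' : R) X X' Xg Xf Xf' G Y' :
  0 < L -> 0 < t -> t <= 1 -> 0 < alpha ->
  X = Xg + (t^-1 - 2^-1) *: (Xg - Xf) ->
  X' = X + ((L * t)^-1 * alpha) *: (Xg - X') - (L * t)^-1 *: (G - Y') ->
  Xf' = Xg + t *: (X' - X) ->
  Df' <= Dg + inner G (Xf' - Xg) + L / 2 * inner (Xf' - Xg) (Xf' - Xg) ->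
  Dg + inner G (Xf - Xg) <= Df ->
  Dg + alpha / 2 * inner Xg Xg <= inner G Xg ->
  (L * t + alpha) * inner X' X' + 2 / t * Df' <=
  L * t * inner X X + (2 / t - 1) * Df + 2 * inner X' Y' - Dg.
Proof.
move=> L0 t0 t1 alpha0 eX eX' eXf' B1 B2 B3.
have GX : inner G X = inner G Xg + (t^-1 - 2^-1) * (inner G Xg - inner G Xf).
  by rewrite {1}eX !innerE.
have {eX'} XX' : L * t * (inner X' X' - inner X X') =
    alpha * (inner Xg X' - inner X' X') - inner G X' + inner X' Y'.
  have := congr1 (fun V => inner V X') eX'; rewrite !innerE (innerC Y') => e.
  rewrite [in X in _ * (X - _)]e; field; rewrite !gt_eqF //.
have {}B1 : 2 / t * Df' <= 2 / t * Dg + 2 * (inner G X' - inner G X)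
    + L * t * inner (X' - X) (X' - X).
  have c0 : 0 <= 2 / t by rewrite divr_ge0 // ltW.
  have /le_trans := ler_wpM2l c0 B1; apply.
  have -> : Xf' - Xg = t *: (X' - X) by rewrite eXf' addrAC subrr add0r.
  rewrite !innerE le_eqVlt; apply/orP; left; apply/eqP; field; rewrite !gt_eqF //.
have {B2} : (2 / t - 1) * (Dg + inner G Xf - inner G Xg) <= (2 / t - 1) * Df.
  apply: ler_wpM2l; last by move: B2; rewrite !innerE addrA.
  by rewrite subr_ge0 ler_pdivlMr // mul1r (le_trans t1) // ler1n.
have := mulr_ge0 (ltW alpha0) (sqnorm_ge0 (Xg - X')).
move: B1 XX' B3; rewrite !innerE (innerC X' X) (innerC X' Xg); lra.
Qed.

(** The implicit update is tested against Y'. The term -2<X', Y'> cancels the one left by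
    [x_estimate], and the negative square of Y' - Y absorbs the increments in [yf_estimate] and
    [s_estimate]. *)
Lemma y_estimate (theta beta nu : R) X' Y Y' G Sg : 0 < theta -> 0 < beta ->
  Y' = Y + (theta * beta) *: (G - Y') - theta *: (nu^-1 *: Sg + X') ->
  (theta^-1 + beta) * inner Y' Y' <= theta^-1 * inner Y Y + beta * inner G G
    - 2 / nu * inner Sg Y' - 2 * inner X' Y' - theta^-1 * inner (Y' - Y) (Y' - Y).
Proof.
move=> theta0 beta0 eY'.
have {eY'} YY' : theta^-1 * (inner Y' Y' - inner Y Y') =
    beta * (inner G Y' - inner Y' Y') - nu^-1 * inner Sg Y' - inner X' Y'.
  have := congr1 (fun V => inner V Y') eY'; rewrite !innerE => e.
  rewrite [in X in _ * (X - _)]e.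
  move: (inner _ _) (nu^-1) => a nV.
  set b := inner _ _.
  by field; rewrite gt_eqF.
have := mulr_ge0 (ltW beta0) (sqnorm_ge0 (G - Y')).
move: YY'; rewrite !innerE (innerC Y' G) (innerC Y' Y); lra.
Qed.

Lemma yf_estimate (s : R) Y Y' Yg Yf Yf' : 0 < s -> s <= 1 ->
  Y = Yg + (s^-1 - 2^-1) *: (Yg - Yf) -> Yf' = Yg + s *: (Y' - Y) ->
  s^-1 * inner Yf' Yf' <= (s^-1 - 2^-1) * inner Yf Yf + inner Y' Y'
    - 2^-1 * inner Yg Yg + s * inner (Y' - Y) (Y' - Y).
Proof.
move=> s0 s1 eY ->.
have -> : s^-1 * inner (Yg + s *: (Y' - Y)) (Yg + s *: (Y' - Y)) =
    s^-1 * inner Yg Yg + 2 * (inner Yg Y' - inner Yg Y) + s * inner (Y' - Y) (Y' - Y).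
  rewrite !innerE (innerC Y' Yg) (innerC Y Yg); field; rewrite gt_eqF //.
have YgY : inner Yg Y = inner Yg Yg + (s^-1 - 2^-1) * (inner Yg Yg - inner Yg Yf).
  by rewrite {1}eY !innerE.
have c0 : 0 <= s^-1 - 2^-1 by rewrite subr_ge0 lef_pV2 ?posrE ?(le_trans s1) ?ler1n.
have := mulr_ge0 c0 (sqnorm_ge0 (Yg - Yf)).
have := sqnorm_ge0 (Yg - Y').
move: (inner (Y' - Y) _) => dY.
rewrite !innerE (innerC Y' Yg) (innerC Yf Yg) YgY; lra.
Qed.

(** Here S stands for the error sum Y + Z, p for the projection of Sg and w for its image under the
    gossip matrix. Contraction gives <p, w> >= |w|^2/2 + |p|^2/(2 chi); with step 1/2 this leaves
    -|w|^2/4, which absorbs the product of w and dY, and the gain in |p|^2 that pays for the error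
    feedback. *)
Lemma s_estimate (s chi : R) S Sg Sf Sf' dY p w :
  0 < s -> s <= 1 -> 0 < chi ->
  S = Sg + (s^-1 - 2^-1) *: (Sg - Sf) -> Sf' = Sg + s *: dY - 2^-1 *: w ->
  inner Sg w = inner p w ->
  inner (w - p) (w - p) <= (1 - chi^-1) * inner p p ->
  s^-1 * inner Sf' Sf' <= (s^-1 - 2^-1) * inner Sf Sf - 3 / 2 * inner Sg Sg
    + 2 * (inner Sg S + inner Sg dY) - (2 * chi * s)^-1 * inner p p
    + 2 * s * inner dY dY.
Proof.
move=> s0 s1 chi0 eS -> Sgw cw.
have SgS : inner Sg S = inner Sg Sg + (s^-1 - 2^-1) * (inner Sg Sg - inner Sg Sf).
  by rewrite {1}eS !innerE.
have c0 : 0 <= s^-1 - 2^-1 by rewrite subr_ge0 lef_pV2 ?posrE ?(le_trans s1) ?ler1n.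
have H1 := mulr_ge0 c0 (sqnorm_ge0 (Sg - Sf)).
have := sqnorm_ge0 (2^-1 *: w + s *: dY).
rewrite -(pmulr_rge0 _ (_ : 0 < s^-1)) ?invr_gt0 // => H2.
have {}cw : s^-1 * inner (w - p) (w - p) <= s^-1 * ((1 - chi^-1) * inner p p).
  by rewrite ler_pM2l ?invr_gt0.
have -> : (2 * chi * s)^-1 = s^-1 * chi^-1 / 2 by field; rewrite !gt_eqF.
have -> : s^-1 * inner (Sg + s *: dY - 2^-1 *: w) (Sg + s *: dY - 2^-1 *: w) =
   s^-1 * inner Sg Sg - s^-1 * inner p w + s^-1 * inner w w / 4
   + 2 * inner Sg dY - inner w dY + s * inner dY dY.
  rewrite !innerE (innerC dY Sg) (innerC dY w) (innerC w Sg) Sgw; field.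
  by rewrite gt_eqF.
have {}H2 : 0 <= s^-1 * inner w w / 4 + inner w dY + s * inner dY dY.
  move: H2; congr (_ <= _); rewrite !innerE (innerC dY w); field.
  by rewrite gt_eqF.
move: H1 cw; rewrite !innerE (innerC p w) (innerC Sf Sg) SgS; lra.
Qed.

(** Here q is the projected memory P m and Zh = Z - q, whose recursion is free of the gossip matrix.
    Testing with Zh instead of Z costs the terms in q. *)
Lemma z_estimate (gamma delta nu : R) Z Zg Zh Zh' Sg p q :
  0 < gamma -> 0 < delta -> 4 * (gamma * delta) <= 1 ->
  Z = Zh + q ->
  Zh' = Zh + (gamma * delta) *: (Zg - Z) - (gamma / nu) *: p ->
  inner p Z = inner Sg Z ->
  gamma^-1 * inner Zh' Zh' <= (gamma^-1 - delta / 2) * inner Zh Zh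
    + delta * inner Zg Zg + 3 * delta * inner q q
    - 2 / nu * inner Sg Z + 2 / nu * inner p q + 2 * gamma / nu ^+ 2 * inner p p.
Proof.
move=> gamma0 delta0 gd eZ -> pZ.
have -> : gamma^-1 * inner (Zh + (gamma * delta) *: (Zg - Z) - (gamma / nu) *: p)
     (Zh + (gamma * delta) *: (Zg - Z) - (gamma / nu) *: p) =
   gamma^-1 * inner Zh Zh + 2 * delta * inner (Zg - Z) Zh - 2 / nu * inner p Zh
   + gamma * inner (delta *: (Zg - Z) - nu^-1 *: p) (delta *: (Zg - Z) - nu^-1 *: p).
  move: (Zg - Z) => V.
  rewrite !innerE (innerC Zh p) (innerC Zh V) (innerC p V); move: (nu^-1) => nV.
  by field; rewrite gt_eqF.
(* From |a - b|^2 <= 2|a|^2 + 2|b|^2; the hypothesis [gd] turns 2 gamma delta^2 into delta/2. *)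
have H1 : gamma * inner (delta *: (Zg - Z) - nu^-1 *: p) (delta *: (Zg - Z) - nu^-1 *: p)
   <= delta / 2 * inner (Zg - Z) (Zg - Z) + 2 * gamma / nu ^+ 2 * inner p p.
  have := mulr_ge0 (ltW gamma0) (sqnorm_ge0 (delta *: (Zg - Z) + nu^-1 *: p)).
  have := ler_wpM2r (mulr_ge0 (ltW delta0) (sqnorm_ge0 (Zg - Z))) gd.
  move: (Zg - Z) => V; rewrite -exprVn !innerE (innerC p V).
  move: (nu^-1) => nV; lra.
have H2 := mulr_ge0 (ltW delta0) (sqnorm_ge0 (Zg - Z + 2 *: q)).
have H3 := mulr_ge0 (ltW delta0) (sqnorm_ge0 (Zh + 2 *: q)).
have pZh : inner p Zh = inner Sg Z - inner p q by rewrite -pZ eZ innerDr addrK.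
move: H1 H2 H3; rewrite pZh; move: (inner (delta *: _ - _) _) => T.
have -> : Zh = Z - q by rewrite eZ addrK.
rewrite -exprVn !innerE (innerC q Zg) (innerC q Z) (innerC Z Zg).
move: (nu^-1) => nV; lra.
Qed.

Lemma m_estimate (chi c : R) q q' p w : 1 <= chi ->
  q' = c *: p + q - w ->
  inner (w - (c *: p + q)) (w - (c *: p + q)) <=
    (1 - chi^-1) * inner (c *: p + q) (c *: p + q) ->
  inner q' q' <= (1 - (2 * chi)^-1) * inner q q + 2 * chi * c ^+ 2 * inner p p.
Proof.
move=> chi1 ->; have chi0 : 0 < chi by exact: lt_le_trans chi1.
rewrite -opprB innerNl innerNr opprK => /le_trans; apply.
have x1 : 0 <= 1 - chi^-1 by rewrite subr_ge0 invf_le1.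
(* The Young weight 1/(2 chi) spends half of the gossip contraction: (1 - 1/chi)(1 + 1/(2 chi)) <= 1
   - 1/(2 chi), while (1 - 1/chi)(1 + 2 chi) <= 2 chi. *)
have H : inner (c *: p + q) (c *: p + q) <=
   (1 + (2 * chi)^-1) * inner q q + (1 + 2 * chi) * (c ^+ 2 * inner p p).
  have a0 : 0 < (2 * chi)^-1 by rewrite invr_gt0 mulr_gt0.
  have := young_inner _ q (c *: p) a0.
  rewrite invrK !innerE (innerC q p) expr2; lra.
have /le_trans := ler_wpM2l x1 H; apply.
rewrite mulrDr !mulrA lerD //.
  apply: ler_wpM2r; first exact: sqnorm_ge0.
  have -> : (2 * chi)^-1 = chi^-1 / 2 by field; rewrite gt_eqF.
  have : 0 < chi^-1 by rewrite invr_gt0.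
  move: (chi^-1) => y; nra.
apply: ler_wpM2r; first exact: sqnorm_ge0.
rewrite -!(mulrA _ c c); apply: ler_wpM2r; first by rewrite -expr2 sqr_ge0.
have -> : (1 - chi^-1) * (1 + 2 * chi) = 2 * chi - 1 - chi^-1 by field; rewrite gt_eqF.
have : 0 < chi^-1 by rewrite invr_gt0.
lra.
Qed.

End StepEstimates.

(* Conditions on the parameters under which the energy below contracts by the
   factor [1 - rho]; the Young constants used in the proof are built in. *)
Record contracting {R : realType} (L chi rho : R) (p : adom_params R) : Prop := {
  L_gt0 : 0 < L;
  chi_ge1 : 1 <= chi;
  tau2_gt0 : 0 < tau2 p;
  tau2_le1 : tau2 p <= 1;
  nu_gt0 : 0 < nu p;
  beta_gt0 : 0 < beta p;
  sigma2_gt0 : 0 < sigma2 p;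
  sigma2_le1 : sigma2 p <= 1;
  theta_gt0 : 0 < theta p;
  gamma_gt0 : 0 < gamma p;
  delta_gt0 : 0 < delta p;
  rate_x : L * tau2 p <= (1 - rho) * (L * tau2 p + nu p);
  rate_D : 2 / tau2 p - 1 <= (1 - rho) * (2 / tau2 p);
  rate_y : (theta p)^-1 <= (1 - rho) * ((theta p)^-1 + beta p / 2);
  rate_yf : (sigma2 p)^-1 - 2^-1 <= (1 - rho) * (sigma2 p)^-1;
  rate_z : (gamma p)^-1 - delta p / 2 <= (1 - rho) * (gamma p)^-1;
  rate_m : (gamma p)^-1 * (1 - (2 * chi)^-1) + 3 / 8 / (chi * gamma p) + 3 * delta p
    <= (1 - rho) * (gamma p)^-1;
  coef_p : 2 * gamma p / nu p ^+ 2 + (gamma p)^-1 * (2 * chi * (gamma p / nu p) ^+ 2)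
    + 8 / 3 * (chi * gamma p) / nu p ^+ 2 <= (nu p)^-1 * (2 * chi * sigma2 p)^-1;
  coef_zg : 4 * (gamma p * delta p) <= 1;
  coef_sg : 2 * delta p <= (nu p)^-1 * (3 / 2);
  coef_yg : 2 * delta p <= beta p / 4;
  coef_dy : beta p / 2 * sigma2 p + 2 * sigma2 p / nu p <= (theta p)^-1 }.

(** * One-step decrease of the energy *)

Section Assembly.
Context {R : realType} {n d : nat} {L chi rho : R} {p : adom_params R}.
Hypothesis p_contr : contracting L chi rho p.
Local Notation t := (tau2 p).
Local Notation alpha := (nu p).
Local Notation nu := (nu p).
Local Notation beta := (beta p).
Local Notation s := (sigma2 p).
Local Notation theta := (theta p).
Local Notation gamma := (gamma p).
Local Notation delta := (delta p).

Definition energy (X : 'M[R]_(n, d)) (D : R) (Y Yf Zh q Sf : 'M[R]_(n, d)) : R :=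
  (L * t + alpha) * inner X X + 2 / t * D
  + (theta^-1 + beta / 2) * inner Y Y + beta / 2 * (s^-1 * inner Yf Yf)
  + gamma^-1 * inner Zh Zh + gamma^-1 * inner q q
  + nu^-1 * (s^-1 * inner Sf Sf).

Lemma energy_ge (X : 'M[R]_(n, d)) (D : R) Y Yf Zh q Sf : 0 <= D ->
  L * t * inner X X <= energy X D Y Yf Zh q Sf.
Proof.
move=> D0; case: p_contr => L0 _ t0 _ nu0 beta0 s0 _ theta0 gamma0 *.
have nonneg (a : R) (u : 'M[R]_(n, d)) : 0 < a -> 0 <= a * inner u u.
  by move=> ?; rewrite mulr_ge0 ?sqnorm_ge0 ?ltW.
have [it is_ inu itheta igamma] : [/\ 0 < t^-1, 0 < s^-1, 0 < nu^-1,
    0 < theta^-1 & 0 < gamma^-1] by rewrite !invr_gt0.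
have := nonneg _ X nu0; have := mulr_ge0 (ltW it) D0.
have := nonneg _ Y itheta; have := nonneg _ Y beta0.
have := mulr_ge0 (ltW beta0) (nonneg _ Yf is_); have := nonneg _ Zh igamma.
have := nonneg _ q igamma; have := mulr_ge0 (ltW inu) (nonneg _ Sf is_).
rewrite /energy; lra.
Qed.

(** The block estimates are added with the weights of the energy. Half of the gain beta |Y'|^2 is
    handed to the [Yf] block; the rate conditions contract each square, and the [coef_] conditions
    make the leftover squares nonpositive. *)
Lemma energy_decrease (G X X' Xg Xf Xf' Y Y' Yg Yf Yf' Z Zg Zf Zh Zh' q q' pS w w'
    S' : 'M[R]_(n, d)) Df Dg Df' :
  X = Xg + (t^-1 - 2^-1) *: (Xg - Xf) ->
  X' = X + ((L * t)^-1 * alpha) *: (Xg - X') - (L * t)^-1 *: (G - Y') ->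
  Xf' = Xg + t *: (X' - X) ->
  0 <= Df ->
  Df' <= Dg + inner G (Xf' - Xg) + L / 2 * inner (Xf' - Xg) (Xf' - Xg) ->
  Dg + inner G (Xf - Xg) <= Df ->
  Dg + alpha / 2 * inner Xg Xg <= inner G Xg ->
  beta * inner G G <= Dg ->
  Y = Yg + (s^-1 - 2^-1) *: (Yg - Yf) ->
  Y' = Y + (theta * beta) *: (G - Y') - theta *: (nu^-1 *: (Yg + Zg) + X') ->
  Yf' = Yg + s *: (Y' - Y) ->
  Z = Zg + (s^-1 - 2^-1) *: (Zg - Zf) ->
  S' = Yg + Zg + s *: (Y' - Y) - 2^-1 *: w ->
  inner (Yg + Zg) w = inner pS w ->
  inner (w - pS) (w - pS) <= (1 - chi^-1) * inner pS pS ->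
  Z = Zh + q ->
  Zh' = Zh + (gamma * delta) *: (Zg - Z) - (gamma / nu) *: pS ->
  inner pS Z = inner (Yg + Zg) Z ->
  q' = (gamma / nu) *: pS + q - w' ->
  inner (w' - ((gamma / nu) *: pS + q)) (w' - ((gamma / nu) *: pS + q)) <=
    (1 - chi^-1) * inner ((gamma / nu) *: pS + q) ((gamma / nu) *: pS + q) ->
  energy X' Df' Y' Yf' Zh' q' S' <=
    (1 - rho) * energy X Df Y Yf Zh q (Yf + Zf).
Proof.
move=> eX eX' eXf' Df_ge0 B1 B2 B3 B4 eY eY' eYf' eZ eS' Sw cw eZh eZh' pZ eq' cq.
case: p_contr => L_gt0 chi_ge1 t_gt0 t_le1 nu_gt0 beta_gt0 s_gt0 s_le1 theta_gt0
  gamma_gt0 delta_gt0 rate_x rate_D rate_y rate_yf rate_z rate_m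
  coef_p coef_V coef_S coef_yg coef_dY.
have chi_gt0 : 0 < chi by exact: lt_le_trans chi_ge1.
have Ex := x_estimate _ _ _ _ _ _ _ _ _ _ _ _ _
  L_gt0 t_gt0 t_le1 nu_gt0 eX eX' eXf' B1 B2 B3.
have Ey := y_estimate _ _ _ _ _ _ _ _ theta_gt0 beta_gt0 eY'.
have Eyf := ler_wpM2l (divr_ge0 (ltW beta_gt0) (ler0n _ 2))
  (yf_estimate _ _ _ _ _ _ s_gt0 s_le1 eY eYf').
have eS : Y + Z = (Yg + Zg) + (s^-1 - 2^-1) *: ((Yg + Zg) - (Yf + Zf)).
  by rewrite {1}eY {1}eZ; apply/matrixP => i j; rewrite !mxE; ring.
have inu_ge0 : 0 <= nu^-1 by rewrite invr_ge0 ltW.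
have ig_ge0 : 0 <= gamma^-1 by rewrite invr_ge0 ltW.
have Es := ler_wpM2l inu_ge0
  (s_estimate _ _ _ _ _ _ _ _ _ s_gt0 s_le1 chi_gt0 eS eS' Sw cw).
have Ez := z_estimate _ _ _ _ _ _ _ _ _ _ gamma_gt0 delta_gt0 coef_V eZh eZh' pZ.
have Em := ler_wpM2l ig_ge0 (m_estimate _ _ _ _ _ _ chi_ge1 eq' cq).
(* The weight 3/(8 chi gamma) takes three quarters of the decrease 1/(2 chi gamma) of |q|^2; the
   last quarter covers 3 delta and the rate. *)
have Epq : 2 / nu * inner pS q <=
    3 / 8 / (chi * gamma) * inner q q + 8 / 3 * (chi * gamma) / nu ^+ 2 * inner pS pS.
  have a0 : 0 < 3 / 8 / (chi * gamma) by rewrite !divr_gt0 // mulr_gt0.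
  have := young_inner _ q (nu^-1 *: pS) a0.
  rewrite !innerE (innerC q pS) => H.
  apply: (le_trans (le_trans _ H)); last first.
    rewrite lerD2l le_eqVlt; apply/orP; left; apply/eqP.
    by field; rewrite !gt_eqF.
  by rewrite mulrA.
have Sg2 : delta * inner Zg Zg <=
    2 * delta * inner (Yg + Zg) (Yg + Zg) + 2 * delta * inner Yg Yg.
  have := mulr_ge0 (ltW delta_gt0) (sqnorm_ge0 (2 *: Yg + Zg)).
  rewrite !innerE (innerC Zg Yg); lra.
have Kx := ler_wpM2r (sqnorm_ge0 X) rate_x.
have KD := ler_wpM2r Df_ge0 rate_D.
have Ky := ler_wpM2r (sqnorm_ge0 Y) rate_y.
have Kyf := ler_wpM2l (divr_ge0 (ltW beta_gt0) (ler0n _ 2))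
  (ler_wpM2r (sqnorm_ge0 Yf) rate_yf).
have KS := ler_wpM2l inu_ge0 (ler_wpM2r (sqnorm_ge0 (Yf + Zf)) rate_yf).
have Kz := ler_wpM2r (sqnorm_ge0 Zh) rate_z.
have Km := ler_wpM2r (sqnorm_ge0 q) rate_m.
have Kp := ler_wpM2r (sqnorm_ge0 pS) coef_p.
have Ksg := ler_wpM2r (sqnorm_ge0 (Yg + Zg)) coef_S.
have Kyg := ler_wpM2r (sqnorm_ge0 Yg) coef_yg.
have KdY := ler_wpM2r (sqnorm_ge0 (Y' - Y)) coef_dY.
(* Weighted by 2/nu, the right-hand side is exactly what [y_estimate] and [z_estimate] subtract. *)
have cross : inner (Yg + Zg) (Y + Z) + inner (Yg + Zg) (Y' - Y) =
    inner (Yg + Zg) Y' + inner (Yg + Zg) Z.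
  by rewrite !innerDr innerNr; ring.
rewrite cross in Es; rewrite /energy.
clear - Ex Ey Eyf Es Ez Em Epq Sg2 Kx KD Ky Kyf KS Kz Km Kp Ksg Kyg KdY B4.
lra.
Qed.
End Assembly.

(** Writing mu = L r^2 makes every parameter rational in L, r and chi, so each condition becomes the
    nonnegativity of an explicit fraction. The rate is [sigma2 p] / 8, as [sigma2 p] = r/(16
    chi). *)
Lemma adom_default_contracting {R : realType} (L r chi : R) :
  0 < L -> 0 < r -> r <= 1 -> 1 <= chi ->
  let p := adom_default L (L * r ^+ 2) chi in
  tau2 p = r /\ contracting L chi (r / (128 * chi)) p.
Proof.
move=> L0 r0 r1 chi1 p; have chi0 : 0 < chi by exact: lt_le_trans chi1.
have Ep2 : tau2 p = r.
  by rewrite /p /= mulrAC divff ?gt_eqF // mul1r sqrtr_sqr gtr0_norm.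
have Es : sigma2 p = r / (16 * chi).
  rewrite /p /= sqrtrM ?ltW // sqrtr_sqr gtr0_norm //.
  by field; rewrite !gt_eqF // sqrtr_gt0.
have Enu : nu p = L * r ^+ 2 / 2 by [].
have Eb : beta p = (2 * L)^-1 by [].
have Ed : delta p = (17 * L)^-1 by [].
have Et : theta p = 2 * L * r * chi.
  rewrite (_ : theta p = nu p / (4 * sigma2 p)) // Enu Es.
  by field; rewrite !gt_eqF.
have Eg : gamma p = 4 * L * r / (7 * chi).
  rewrite (_ : gamma p = nu p / (14 * sigma2 p * chi ^+ 2)) // Enu Es.
  by field; rewrite !gt_eqF.
split=> //; move: p Ep2 Es Enu Eb Ed Et Eg => p Ep2 Es Enu Eb Ed Et Eg.
have rchi : r <= chi by exact: le_trans chi1.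
have r2 : r ^+ 2 <= 1 by rewrite exprn_ile1 // ltW.
split; rewrite ?Ep2 ?Es ?Enu ?Eb ?Ed ?Et ?Eg //.
all: try by rewrite ?invr_gt0 ?divr_gt0 ?mulr_gt0 ?exprn_gt0.
all: try (rewrite -subr_ge0).
- rewrite subr_ge0 ler_pdivrMr ?mulr_gt0 // mul1r; lra.
- rewrite (_ : _ - _ = L * r ^+ 2 * (64 * chi - 1 - r / 2) / (128 * chi)).
    by rewrite divr_ge0 ?mulr_ge0 ?ltW ?exprn_gt0 //; lra.
  by field; rewrite !gt_eqF.
- rewrite (_ : _ - _ = (64 * chi - 1) / (64 * chi)).
    by rewrite divr_ge0 ?mulr_ge0 ?ltW //; lra.
  by field; rewrite !gt_eqF.
- rewrite (_ : _ - _ = (128 * chi ^+ 2 - 2 - r * chi) / 512 / (L * chi ^+ 2)).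
    by apply: divr_ge0; [nra|rewrite ltW ?mulr_gt0 ?exprn_gt0].
  by field; rewrite !gt_eqF.
- rewrite (_ : _ - _ = 3 / 8); first lra.
  by field; rewrite !gt_eqF.
- rewrite (_ : _ - _ = (34^-1 - 7 / 512) / L).
    by apply: divr_ge0; [lra|exact: ltW].
  by field; rewrite !gt_eqF.
- rewrite (_ : _ - _ = (7 / 32 * r^-1 - 3 / 17 - 7 / 512) / L).
    have : 1 <= r^-1 by rewrite invf_ge1.
    by move=> ?; apply: divr_ge0; [lra|exact: ltW].
  by field; rewrite !gt_eqF.
(* The factor 14 in gamma enters here: the condition reduces to 2 + 14 chi / 3 <= 7 chi. *)
- rewrite (_ : _ - _ = 32 * (7 * chi - 6) / (42 * L * r ^+ 3 * chi)).
    by rewrite divr_ge0 ?mulr_ge0 ?ltW ?exprn_gt0 //; lra.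
  by field; rewrite !gt_eqF.
- rewrite (_ : _ - _ = (119 * chi - 16 * r) / (119 * chi)).
    by rewrite divr_ge0 ?mulr_ge0 ?ltW //; lra.
  by field; rewrite !gt_eqF.
- rewrite (_ : _ - _ = (51 - 2 * r ^+ 2) / (17 * L * r ^+ 2)).
    by rewrite divr_ge0 ?mulr_ge0 ?ltW ?exprn_gt0 //; lra.
  by field; rewrite !gt_eqF.
(* This is 1/8 - 2/17 over L; the condition asks for delta <= 1/(16 L), just above 1/(17 L). *)
- rewrite (_ : _ - _ = (136 * L)^-1).
    by rewrite invr_ge0 mulr_ge0 ?ltW.
  by field; rewrite !gt_eqF.
- rewrite (_ : _ - _ = (16 - r ^+ 2) / (64 * L * r * chi)).
    by rewrite divr_ge0 ?mulr_ge0 ?ltW //; lra.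
  by field; rewrite !gt_eqF.
Qed.

(** * The energy along the iterates *)

Section Iteration.
Context {R : realType} {n d : nat} {F : 'M[R]_(n, d) -> R} {L mu chi rho : R}.
Context {p : adom_params R}.
Hypotheses (p_contr : contracting L chi rho p) (mu_gt0 : 0 < mu).
Hypotheses
  (tau1E : tau1 p = ((tau2 p)^-1 + 2^-1)^-1) (etaE : eta p = (L * tau2 p)^-1)
  (alphaE : alpha p = nu p) (nuE : nu p = mu / 2) (betaE : beta p = (2 * L)^-1)
  (sigma1E : sigma1 p = ((sigma2 p)^-1 + 2^-1)^-1) (zetaE : zeta p = 2^-1).
Hypothesis F_smooth : forall u v : 'M[R]_(n, d),
  F u <= F v + inner (grad F v) (u - v) + L / 2 * inner (u - v) (u - v).
Hypothesis F_convex : forall u v : 'M[R]_(n, d),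
  F v + inner (grad F v) (u - v) + mu / 2 * inner (u - v) (u - v) <= F u.
Variable xs : 'M[R]_(n, d).
Hypotheses (xs_cst : consensus R n d xs) (gs_zero : zero_sum R n d (grad F xs)).
Local Notation gs := (grad F xs).
Local Notation P := (centering_mx R n).

Definition lyapunov (s : adom_state R n d) : R :=
  @energy R n d L p (st_x s - xs) (@breg R n d F (grad F) mu xs (st_xf s))
    (st_y s - (gs - nu p *: xs)) (st_yf s - (gs - nu p *: xs))
    (st_z s + gs - P *m st_m s) (P *m st_m s)
    (st_yf s - (gs - nu p *: xs) + (st_zf s + gs)).

Lemma lyapunov_ge s :
  L * tau2 p * inner (st_x s - xs) (st_x s - xs) <= lyapunov s.
Proof.
rewrite /lyapunov; apply: (energy_ge p_contr).
exact: (breg_ge0 F_convex mu_gt0 xs).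
Qed.

Definition dual_zero_sum (s : adom_state R n d) : Prop :=
  zero_sum R n d (st_z s) /\ zero_sum R n d (st_zf s).

(** Every term of both updates is zero-sum, since the range of W is. This invariant lets P be
    inserted in inner products with the error of z. *)
Lemma adom_step_zero_sum E W s s' : gossip_matrix chi E W ->
  adom_step p F W s s' -> dual_zero_sum s -> dual_zero_sum s'.
Proof.
move=> gW [_ [ez _ ezf]] [z0 zf0].
have w0 := @gossip_zero_sum _ _ _ _ _ gW d.
have zg0 := zero_sum_lin (sigma1 p) (1 - sigma1 p) _ _ z0 zf0.
have fix_z := zero_sum_center _ z0; have fix_zg := zero_sum_center _ zg0.
split; rewrite ?ez ?ezf; set w := W *m _.
  rewrite (_ : _ - w = P *m (st_z s + (gamma p * delta p) *:
      (sigma1 p *: st_z s + (1 - sigma1 p) *: st_zf s - st_z s) - w)).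
    exact: center_zero_sum.
  rewrite mulmxBr mulmxDr -scalemxAr mulmxBr fix_z fix_zg.
  by rewrite (zero_sum_center _ (w0 _)).
by rewrite -[X in X - _]scale1r -scaleNr; apply: zero_sum_lin => //; apply: w0.
Qed.

Lemma lyapunov_step E W s s' : gossip_matrix chi E W ->
  adom_step p F W s s' -> dual_zero_sum s ->
  lyapunov s' <= (1 - rho) * lyapunov s.
Proof.
case: s s' => [x xf y yf z zf m] [x' xf' y' yf' z' zf' m'] gW.
rewrite /adom_step /dual_zero_sum /lyapunov /=.
have [xg exg] : exists xg : 'M[R]_(n, d), xg = tau1 p *: x + (1 - tau1 p) *: xf by eexists.
have [yg eyg] : exists yg : 'M[R]_(n, d), yg = sigma1 p *: y + (1 - sigma1 p) *: yf by eexists.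
have [zg ezg] : exists zg : 'M[R]_(n, d), zg = sigma1 p *: z + (1 - sigma1 p) *: zf by eexists.
rewrite -exg -eyg -ezg => -[[ex' exf' ey' eyf'] [ez' em' ezf']] [z0 zf0].
have L0 := L_gt0 _ _ _ _ p_contr; have t0 := tau2_gt0 _ _ _ _ p_contr.
have s0 := sigma2_gt0 _ _ _ _ p_contr.
have nu0 := nu_gt0 _ _ _ _ p_contr.
have Wzero := @gossip_zero_sum _ _ _ _ _ gW d.
have PW (u : 'M[R]_(n, d)) : P *m (W *m u) = W *m u by exact: zero_sum_center (Wzero u).
have xs_center : P *m (nu p *: xs) = 0 by rewrite -scalemxAr consensus_center ?scaler0.
have W_xs : W *m (nu p *: xs) = 0 by rewrite -scalemxAr (gossip_consensus gW) ?scaler0.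
(* The error sum differs from yg + zg by a consensus vector, which both P and W annihilate. *)
have eS : yg - (gs - nu p *: xs) + (zg + gs) = yg + zg + nu p *: xs.
  by apply/matrixP => i j; rewrite !mxE; ring.
have Pu : (gamma p / nu p) *: (P *m (yg + zg)) + P *m m =
    P *m ((gamma p / nu p) *: (yg + zg) + m) by rewrite [RHS]mulmxDr -scalemxAr.
have contr (u v : 'M[R]_(n, d)) : v = P *m u ->
    inner (W *m u - v) (W *m u - v) <= (1 - chi^-1) * inner v v.
  move=> ->; rewrite -(gossip_center gW); exact/(gossip_contract gW)/center_zero_sum.
have zero_Z : zero_sum R n d (z + gs).
  by rewrite -[z]scale1r -[gs]scale1r; apply: zero_sum_lin.
have PS : P *m (yg - (gs - nu p *: xs) + (zg + gs)) = P *m (yg + zg).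
  by rewrite eS mulmxDr xs_center addr0.
have WS : W *m (yg - (gs - nu p *: xs) + (zg + gs)) = W *m (yg + zg).
  by rewrite eS mulmxDr W_xs addr0.
have em : P *m m' = (gamma p / nu p) *: (P *m (yg + zg)) + P *m m
    - W *m ((gamma p / nu p) *: (yg + zg) + m).
  by rewrite Pu em' mulmxBr PW.
apply: (energy_decrease p_contr (@dbreg R n d (grad F) mu xs xg)
  _ _ (xg - xs) (xf - xs) (xf' - xs) _ _ (yg - (gs - nu p *: xs)) _ _
  (z + gs) (zg + gs) (zf + gs) _ _ _ _ (P *m (yg + zg)) (W *m (yg + zg))
  (W *m ((gamma p / nu p) *: (yg + zg) + m)) _ _ (@breg R n d F (grad F) mu xs xg)).
- apply: (momentumK (tau2 p)) => //; rewrite exg tau1E.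
  by apply/matrixP => i j; rewrite !mxE; ring.
- rewrite {1}ex' /dbreg -nuE etaE alphaE.
  by apply/matrixP => i j; rewrite !mxE; ring.
- by rewrite exf'; apply/matrixP => i j; rewrite !mxE; ring.
- exact: breg_ge0.
- rewrite (_ : xf' - xs - (xg - xs) = xf' - xg); last by rewrite opprB addrA subrK.
  exact: breg_le.
- rewrite (_ : xf - xs - (xg - xs) = xf - xg); last by rewrite opprB addrA subrK.
  have := breg_ge F_convex xs xf xg.
  have := mulr_ge0 (ltW mu_gt0) (sqnorm_ge0 (xf - xg)); lra.
- have := breg_monotone F_convex xs xg; rewrite nuE; lra.
- rewrite betaE; exact: breg_dual.
- apply: (momentumK (sigma2 p)) => //; rewrite eyg sigma1E.
  by apply/matrixP => i j; rewrite !mxE; ring.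
- rewrite eS {1}ey' /dbreg -nuE.
  by apply/matrixP => i j; rewrite !mxE; field; rewrite gt_eqF.
- by rewrite eyf'; apply/matrixP => i j; rewrite !mxE; ring.
- apply: (momentumK (sigma2 p)) => //; rewrite ezg sigma1E.
  by apply/matrixP => i j; rewrite !mxE; ring.
- rewrite eyf' ezf' zetaE; move: (W *m _) => w.
  by apply/matrixP => i j; rewrite !mxE; ring.
- by rewrite -PS -WS inner_center_zero_sum.
- exact: contr.
- by rewrite subrK.
(* The same W term is subtracted from z and from P m, hence it drops out of z - P m. *)
- rewrite em ez'; move: (W *m _) (P *m _) (P *m _) => w q1 q2.
  by apply/matrixP => i j; rewrite !mxE; ring.
- by rewrite -PS inner_center_zero_sum.
- exact: em.
- by apply: contr; rewrite Pu.
Qed.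

Lemma lyapunov_run E W s0 s : (forall k, gossip_matrix chi (E k) (W k)) ->
  adom_run p F W s0 s -> dual_zero_sum s0 -> rho <= 1 ->
  forall k, lyapunov (s k) <= (1 - rho) ^+ k * lyapunov s0.
Proof.
move=> gW [<- run] s0_zero rho1 k.
have [] : dual_zero_sum (s k) /\
    lyapunov (s k) <= (1 - rho) ^+ k * lyapunov (s 0%N); last by [].
elim: k => [|k [zk IH]]; first by rewrite expr0 mul1r.
split; first exact: adom_step_zero_sum (gW k) (run k) zk.
apply: (le_trans (lyapunov_step _ _ _ _ (gW k) (run k) zk)).
by rewrite exprS -mulrA ler_wpM2l // subr_ge0.
Qed.

End Iteration.

(** * From linear contraction to the iteration count *)

Lemma expr_contraction_le {R : realType} (rho eps : R) (k : nat) :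
  0 <= rho <= 1 -> 0 < eps -> 2 * ln (1 / eps) <= rho * k%:R ->
  (1 - rho) ^+ k <= eps ^+ 2.
Proof.
move=> /andP[rho0 rho1] eps0 le_k.
apply: (@le_trans _ _ (expR (- rho) ^+ k)).
  by rewrite lerXn2r ?nnegrE ?subr_ge0 ?expR_ge0 // expR_ge1Dx.
rewrite -expRM_natr -[X in _ <= X ^+ 2](@lnK R) // -expRM_natr ler_expR.
by move: le_k; rewrite div1r lnV ?posrE //; lra.
Qed.

Theorem theorem4 (R : realType) :
  exists C : R, 0 < C /\
  forall (n d : nat) (f : 'I_n -> 'rV[R]_d -> R) (L mu chi : R)
    (xstar x0 y0 z0 m0 : 'M[R]_(n, d)),
  0 < mu -> mu <= L -> 1 <= chi ->
  (forall i, smooth L (f i) /\ strongly_convex mu (f i)) ->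
  is_minimizer (sum_objective f) (consensus R n d) xstar ->
  zero_sum R n d z0 ->
  exists eps0 : R, 0 < eps0 /\
  forall (E : nat -> rel 'I_n) (W : nat -> 'M[R]_n)
    (s : nat -> adom_state R n d),
  (forall q, irreflexive (E q)) ->
  (forall q, gossip_matrix chi (E q) (W q)) ->
  adom_run (adom_default L mu chi) (sum_objective f) W
    (adom_init x0 y0 z0 m0) s ->
  forall (eps : R) (k : nat), 0 < eps -> eps < eps0 ->
  C * (chi * Num.sqrt (L / mu) * ln (1 / eps)) <= k%:R ->
  sqnorm (st_x (s k) - xstar) <= eps.
Proof.
(* 256 = 2 * 128: the rate r/(128 chi) times k then exceeds 2 ln(1/eps), which yields the factor
   eps^2. *)
exists 256; split=> // n d f L mu chi xs x0 y0 z0 m0 mu0 muL chi1 f_reg xs_min z0_zero.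
have L0 : 0 < L by exact: lt_le_trans muL.
have chi0 : 0 < chi by exact: lt_le_trans chi1.
have [r [r0 r1 Emu]] : exists r, [/\ 0 < r, r <= 1 & mu = L * r ^+ 2].
  have muL0 : 0 < mu / L by rewrite divr_gt0.
  exists (Num.sqrt (mu / L)); split; first by rewrite sqrtr_gt0.
    by rewrite -sqrtr1 ler_wsqrtr // ler_pdivrMr // mul1r.
  by rewrite sqr_sqrtr ?ltW // mulrC divfK ?gt_eqF.
have rV : Num.sqrt (L / mu) = r^-1.
  rewrite Emu (_ : L / _ = r^-1 ^+ 2); last by field; rewrite !gt_eqF.
  by rewrite sqrtr_sqr gtr0_norm ?invr_gt0.
have [p_t p_contr] := adom_default_contracting L r chi L0 r0 r1 chi1.
rewrite -Emu in p_t p_contr; set p := adom_default L mu chi in p_t p_contr *.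
have F_smooth := @sum_objective_smooth _ _ _ _ _ _ f_reg.
have F_convex := @sum_objective_strongly_convex _ _ _ _ _ _ f_reg.
have gs_zero := grad_minimizer_zero_sum f_reg xs L0 xs_min.
pose Psi := @lyapunov R n d (sum_objective f) L mu p xs.
pose s0 := adom_init x0 y0 z0 m0.
pose c := Psi s0 / (L * r).
have Lr0 : 0 < L * r by rewrite mulr_gt0.
have Psi_ge s : L * r * sqnorm (st_x s - xs) <= Psi s.
  by rewrite -p_t; apply: (lyapunov_ge p_contr mu0 F_convex).
have c0 : 0 <= c.
  apply: divr_ge0; last exact: ltW.
  by apply: le_trans (Psi_ge s0); rewrite mulr_ge0 ?sqnorm_ge0 ?ltW.
(* Below 1/(c + 1) one has c eps <= 1, so one factor eps absorbs the normalized initial energy c;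
   adding 1 keeps the denominator positive when c = 0. *)
exists (Num.min 1 (c + 1)^-1); split.
  by rewrite lt_min ltr01 invr_gt0 ltr_wpDl.
move=> E W s _ gW run eps k eps0; rewrite lt_min => /andP[eps1 eps_c].
rewrite rV => le_k.
have rho01 : 0 <= r / (128 * chi) <= 1.
  have d0 : 0 < 128 * chi by rewrite mulr_gt0.
  by apply/andP; split; [exact/ltW/divr_gt0 | rewrite ler_pdivrMr // mul1r; lra].
have rho_k : 2 * ln (1 / eps) <= r / (128 * chi) * k%:R.
  apply: (le_trans _ (ler_wpM2l (andP rho01).1 le_k)).
  by rewrite le_eqVlt; apply/orP; left; apply/eqP; field; rewrite !gt_eqF.
have contr_k := expr_contraction_le _ _ _ rho01 eps0 rho_k.
have Psi_k : Psi (s k) <= (1 - r / (128 * chi)) ^+ k * Psi s0.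
  have [_ rho1] := andP rho01.
  by apply: (lyapunov_run p_contr mu0 _ _ _ _ _ _ _ F_smooth F_convex xs xs_min.1
    gs_zero E W s0 s gW run _ rho1 k).
have ceps : c * eps <= 1.
  apply: (@le_trans _ _ ((c + 1) * eps)); first by rewrite ler_wpM2r ?ltW ?ltrDl.
  by rewrite mulrC -ler_pdivlMr ?ltr_wpDl // div1r ltW.
rewrite -(ler_pM2l Lr0) (le_trans (Psi_ge _)) // (le_trans Psi_k) //.
have Psi_s0 : Psi s0 = L * r * c by rewrite /c mulrC divfK ?gt_eqF.
rewrite Psi_s0 mulrCA ler_pM2l //.
apply: (le_trans (ler_wpM2r c0 contr_k)).
rewrite expr2 -mulrA -[X in _ <= X]mulr1 ler_pM2l // mulrC.
exact: ceps.
Qed.
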